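(* Let $d\in\{4,5\}$ and $m=2d+3$. Then $\gamma^d_m(K^d)=\frac{d-1}{d}$.
   Context: $K^d=\{(x_1,\ldots,x_d)\in\mathbb{R}^d : |x_1|+\cdots+|x_d|\le 1\}$ is the $d$-dimensional crosspolytope. For a convex body $K\subset\mathbb{R}^d$ with non-empty interior and a positive integer $m$, $$\gamma^d_m(K)=\min\Big\{\lambda>0 : \exists\, u_1,\ldots,u_m\in\mathbb{R}^d \text{ such that } K\subseteq\bigcup_{i=1}^m(\lambda K+u_i)\Big\},$$ i.e. the smallest positive $\lambda$ such that $K$ can be covered by $m$ translates of $\lambda K$. *)

(* Defs.v *)
From HB Require Import structures.
From mathcomp Require Import all_boot all_order all_algebra.
From mathcomp Require Import boolp classical_sets reals.

Set Implicit Arguments.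
Unset Strict Implicit.
Unset Printing Implicit Defensive.

Import Order.TTheory GRing.Theory Num.Theory.

Local Open Scope classical_set_scope.
Local Open Scope ring_scope.

Definition crosspolytope (R : realType) (d : nat) : set 'rV[R]_d :=
  [set x | \sum_(i < d) `|x ord0 i| <= 1].

Arguments crosspolytope : clear implicits.

Definition homothet (R : realType) (d : nat) (l : R) (K : set 'rV[R]_d)
    (u : 'rV[R]_d) : set 'rV[R]_d :=
  [set l *: x + u | x in K].

Definition covering_ratios (R : realType) (d m : nat) (K : set 'rV[R]_d) :
    set R :=
  [set l | 0 < l /\
    exists u : 'I_m -> 'rV[R]_d, K `<=` \bigcup_i homothet l K (u i)].

(* A genuine minimum, not an infimum: [gamma] is the least element of
   [covering_ratios m K] when there is one, and 0 otherwise.  Since every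
   covering ratio is positive, [gamma m K = v] with [0 < v] asserts that the
   minimum is attained and equals [v] (see [gammaP]). *)
Definition gamma (R : realType) (d m : nat) (K : set 'rV[R]_d) : R :=
  xget 0 (covering_ratios m K `&` lbound (covering_ratios m K)).

Lemma gammaP (R : realType) (d m : nat) (K : set 'rV[R]_d) (v : R) :
  0 < v ->
  gamma m K = v <->
  covering_ratios m K v /\ (forall l, covering_ratios m K l -> v <= l).
Proof.
move=> v0; split=> [|[Kv vmin]]; rewrite /gamma; case: xgetP.
- by move=> w _ [Kw wmin] <-; split => // l /wmin.
- by move=> _ /eqP; rewrite eq_sym gt_eqF.
- move=> w _ [Kw wmin]; apply/eqP; rewrite eq_le (vmin _ Kw) andbT.
  exact: wmin.
- by move=> /(_ v) []; split => // l /vmin.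
Qed.

(* Main.v *)
Require Import Defs.
From mathcomp Require Import all_boot all_order all_algebra.
From mathcomp Require Import boolp classical_sets reals.
From mathcomp Require Import ring lra.

(** Write [K] for the crosspolytope, the unit ball of the l1 norm, so that a
    translate of [l K] is an l1 ball of radius [l] and has diameter [2 l].

    Upper bound: for [d >= 2], the [2 d] balls of radius [(d - 1) / d] around
    the points [+- e_j / d] cover [K].  A point of [K] lies in the ball that
    belongs to its coordinate of largest absolute value, with the sign of that
    coordinate ([axis_balls_cover]).

    Lower bound: suppose that [m] balls of radius [l < (d - 1) / d] cover [K].
    The [2 d] vertices [+- e_j] have pairwise distance [2], so they lie in
    different balls.  The centre [(+- 1/d, ..., +- 1/d)] of a facet has distance
    at least [2 (d - 1) / d] from every vertex, so it lies in none of these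
    [2 d] balls, and only [m - 2 d] balls remain for the [2 ^ d] facet centres.
    Two facet centres whose signs differ in [k] places have distance [2 k / d],
    so they cannot share a ball if [k >= d - 1].  Hence the covering gives a
    colouring, with [m - 2 d] colours, of the graph on sign vectors in which
    adjacency means differing in at least [d - 1] places
    ([covering_colouring]).

    For [d = 4] this graph is the Clebsch graph, and for [d = 5] it contains
    the Clebsch graph: a parity bit appended to two words of length 4 at
    Hamming distance 3 or 4 makes them differ in exactly 4 places.  The Clebsch
    graph has 16 vertices and no independent set of more than 5
    ([independent_card]), so three colours reach at most 15 vertices
    ([colouring_card]). *)

Set Implicit Arguments.
Unset Strict Implicit.
Unset Printing Implicit Defensive.

Import Order.TTheory GRing.Theory Num.Theory.

Local Open Scope classical_set_scope.
Local Open Scope ring_scope.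

(** * The Clebsch graph is not 3-colourable *)

Definition word : finType := (bool * bool * bool * bool)%type.

Definition bits (x : word) : seq bool :=
  let: (a, b, c, e) := x in [:: a; b; c; e].

Definition xorw (x y : word) : word :=
  let: (a, b, c, e) := x in let: (a', b', c', e') := y in
  (a (+) a', b (+) b', c (+) c', e (+) e').

(** Joining words at Hamming distance 3 or 4 gives the folded 5-cube, that is,
    the Clebsch graph. *)
Definition clebsch : rel word :=
  [rel x y | 2 < count id (bits (xorw x y))]%N.

Lemma xorw_inj v : injective (xorw v).
Proof.
apply: (can_inj (g := xorw v)).
by move: v => [[[[] []] []] []] [[[[] []] []] []].
Qed.

Lemma clebsch_xorw v x y : clebsch (xorw v x) (xorw v y) = clebsch x y.
Proof.
have E p q r : (p (+) q) (+) (p (+) r) = q (+) r by case: p q r => [] [] [].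
rewrite /clebsch /=; suff -> : xorw (xorw v x) (xorw v y) = xorw x y by [].
case: v x y => [[[a b] c] e] [[[a1 b1] c1] e1] [[[a2 b2] c2] e2] /=.
by rewrite !E.
Qed.

Local Notation O := false.
Local Notation I := true.

Definition clebsch_nbrs : seq word :=
  [:: (I, I, I, I); (O, I, I, I); (I, O, I, I); (I, I, O, I); (I, I, I, O)].

(** The ten words that are neither zero nor adjacent to zero induce a Petersen
    graph; [pentagon1] and [pentagon2] are two disjoint 5-cycles in it. *)
Definition pentagon1 : seq word :=
  [:: (I, O, O, O); (O, I, I, O); (I, O, O, I); (O, O, I, O); (O, I, O, I)].

Definition pentagon2 : seq word :=
  [:: (O, I, O, O); (I, O, I, O); (O, O, O, I); (I, I, O, O); (O, O, I, I)].

Lemma pentagon_count (A : pred word) x0 x1 x2 x3 x4 :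
  (forall x y, clebsch x y -> A x -> ~~ A y) ->
  cycle clebsch [:: x0; x1; x2; x3; x4] ->
  (count A [:: x0; x1; x2; x3; x4] <= 2)%N.
Proof.
move=> indep /= /and5P[/indep/implyP e0 /indep/implyP e1 /indep/implyP e2].
move=> /indep/implyP e3; rewrite andbT => /indep/implyP e4; move: e0 e1 e2 e3 e4.
by case: (A x0); case: (A x1); case: (A x2); case: (A x3); case: (A x4).
Qed.

(** The graph is invariant under translation, so an independent set may be
    assumed to contain zero.  Then it avoids the five neighbours of zero and
    has at most two vertices on each of the two pentagons: [1 + 2 + 2]. *)
Lemma independent_card (A : pred word) :
  (forall x y, clebsch x y -> A x -> ~~ A y) -> (#|A| <= 5)%N.
Proof.
move=> indep; have [v Av|A0] := pickP A; last by rewrite eq_card0.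
pose B := A \o xorw v.
have indepB x y : clebsch x y -> B x -> ~~ B y.
  by rewrite -(clebsch_xorw v); apply: indep.
pose zero : word := (O, O, O, O).
have B0 : B zero.
  by rewrite /B /=; case: v Av {B indepB} => [[[a b] c] e] /=; rewrite !addbF.
pose L := zero :: clebsch_nbrs ++ pentagon1 ++ pentagon2.
have enumL : perm_eq (enum word) (map (xorw v) L).
  apply: uniq_perm; first exact: enum_uniq.
    by rewrite (map_inj_uniq (@xorw_inj v)).
  have [] := uniq_min_size (s1 := map (xorw v) L) (s2 := enum word).
  - by rewrite (map_inj_uniq (@xorw_inj v)).
  - by move=> x _; rewrite mem_enum.
  - by rewrite -cardE !card_prod card_bool.
  by move=> _ eqL x; rewrite eqL.
have -> : #|A| = count B L.
  by rewrite -(count_map (xorw v)) -(permP enumL) enumT cardE -size_filter.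
rewrite /L -cat1s !count_cat [count B [:: _]]/= B0.
have -> : count B clebsch_nbrs = 0%N.
  apply/eqP; rewrite -leqn0 leqNgt -has_count; apply/hasPn => x nx.
  by apply: indepB B0; move: x nx; apply/allP.
rewrite !addn0 add0n -[5%N]/(1 + (2 + 2))%N leq_add2l.
by apply: leq_add; apply: pentagon_count.
Qed.

(** Each colour class is independent, so it has at most 5 of the 16 words. *)
Lemma colouring_card (T : finType) (c : word -> T) (J : {set T}) :
  (forall x y, clebsch x y -> c x != c y) -> (forall x, c x \in J) ->
  (16 <= 5 * #|J|)%N.
Proof.
move=> proper cJ.
have -> : 16%N = #|word| by rewrite !card_prod card_bool.
rewrite -[#|word|]sum1_card (partition_big c [in J]) //= mulnC -sum_nat_const.
apply: leq_sum => j _; rewrite sum1_card.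
apply: (independent_card (A := [pred x | c x == j])) => x y xy /= /eqP <-.
by rewrite eq_sym proper.
Qed.

(** * The l1 metric on the crosspolytope *)

Section L1.
Variables (R : realType) (d : nat).
Implicit Types (x y u : 'rV[R]_d) (j : 'I_d) (s : bool).

Definition norm1 x : R := \sum_(i < d) `|x ord0 i|.

Lemma norm1_distC x y : norm1 (x - y) = norm1 (y - x).
Proof. by apply: eq_bigr => i _; rewrite !mxE distrC. Qed.

Lemma norm1_triangle y x z : norm1 (x - z) <= norm1 (x - y) + norm1 (y - z).
Proof.
rewrite /norm1 -big_split; apply: ler_sum => i _; rewrite !mxE.
exact: ler_distD.
Qed.

Lemma homothetP (l : R) u x : 0 < l ->
  homothet l (crosspolytope R d) u x <-> norm1 (x - u) <= l.
Proof.
have norm1Z a z : 0 <= a -> norm1 (a *: z) = a * norm1 z.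
  move=> a0; rewrite /norm1 mulr_sumr; apply: eq_bigr => i _.
  by rewrite mxE normrM ger0_norm.
move=> l0; split=> [[z Kz <-]|xu].
  by rewrite addrK (norm1Z _ _ (ltW l0)) ger_pMr.
exists (l^-1 *: (x - u)); last by rewrite scalerA divff ?gt_eqF // scale1r subrK.
rewrite /crosspolytope /= -/(norm1 _) norm1Z ?invr_ge0 ?(ltW l0) //.
by rewrite mulrC ler_pdivrMr // mul1r.
Qed.

Definition axis_point (a : R) j s : 'rV[R]_d := ((-1) ^+ s * a) *: delta_mx 0 j.

Lemma norm1_sub_axis x a j s :
  norm1 (x - axis_point a j s) =
  `|x ord0 j - (-1) ^+ s * a| + \sum_(i < d | i != j) `|x ord0 i|.
Proof.
rewrite /norm1 (bigD1 j) //=; congr (`|_| + _).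
  by rewrite !mxE !eqxx mulr1.
by apply: eq_bigr => i /negbTE ij; rewrite !mxE ij andbF mulr0 subr0.
Qed.

Lemma norm1_axis a j s : norm1 (axis_point a j s) = `|a|.
Proof.
rewrite /norm1 (bigD1 j) //= big1 ?addr0.
  by rewrite !mxE !eqxx mulr1 normrMsign.
by move=> i /negbTE ij; rewrite !mxE ij andbF mulr0 normr0.
Qed.

Lemma vertex_dist j j' s s' :
  (j, s) != (j', s') -> norm1 (axis_point 1 j s - axis_point 1 j' s') = 2.
Proof.
rewrite xpair_eqE norm1_sub_axis !mxE !eqxx /=.
have [<- /= ss'|jj' _] := eqVneq j j'.
  rewrite big1 ?addr0 => [|i /negbTE ij]; last first.
    by rewrite !mxE ij andbF mulr0 normr0.
  by case: s s' ss' => [] [] //= _; rewrite !(expr0, expr1, mulr1);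
    [rewrite ler0_norm | rewrite ger0_norm]; lra.
rewrite (bigD1 j) //= big1 ?addr0.
  by rewrite !mxE !eqxx !mulr1 mulr0 sub0r normrN !normr_sign.
by move=> i /andP[_ /negbTE ij]; rewrite !mxE ij andbF mulr0 normr0.
Qed.

Definition facet_centre (f : 'I_d -> bool) : 'rV[R]_d :=
  \row_i ((-1) ^+ f i / d%:R).

Lemma norm_facet_centre f i : `|facet_centre f ord0 i| = d%:R^-1.
Proof. by rewrite mxE normrMsign ger0_norm // invr_ge0. Qed.

Lemma norm1_facet_centre f : (0 < d)%N -> norm1 (facet_centre f) = 1.
Proof.
move=> d0; rewrite /norm1; under eq_bigr do rewrite norm_facet_centre.
by rewrite sumr_const card_ord -[LHS]mulr_natr mulVf // pnatr_eq0 -lt0n.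
Qed.

Lemma facet_centre_vertex_dist f j s :
  2 * ((d%:R - 1) / d%:R) <= norm1 (facet_centre f - axis_point 1 j s).
Proof.
have d0 : (0 < d)%N by case: (d) j => [[]|].
have dR : d%:R != 0 :> R by rewrite pnatr_eq0 -lt0n.
rewrite norm1_sub_axis mulr1.
under eq_bigr do rewrite norm_facet_centre.
have -> : \sum_(i < d | i != j) d%:R^-1 = (d%:R - 1) / d%:R :> R.
  rewrite sumr_const cardC1 card_ord -[LHS]mulr_natl.
  by rewrite -subn1 natrB.
have := lerB_dist ((-1) ^+ s) (facet_centre f ord0 j).
rewrite distrC norm_facet_centre normr_sign.
have -> : (d%:R - 1) / d%:R = 1 - d%:R^-1 :> R by field.
lra.
Qed.

Lemma facet_centre_dist f g :
  norm1 (facet_centre f - facet_centre g) = 2 * #|[pred i | f i != g i]|%:R / d%:R.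
Proof.
rewrite -sum1_card natr_sum mulr_sumr mulr_suml [RHS]big_mkcond /norm1.
apply: eq_bigr => i _; rewrite !mxE -mulrBl normrM (@ger0_norm _ d%:R^-1) ?invr_ge0 //=.
rewrite inE; case: (f i) (g i) => [] [] /=;
  rewrite ?(expr0, expr1) ?subrr ?normr0 ?mul0r // mulr1; congr (_ * _);
  by [rewrite ler0_norm; lra | rewrite ger0_norm; lra].
Qed.

(** * Upper bound *)

(** Let [a] be the largest absolute coordinate of [x], at [j].  The other
    coordinates add up to at most [1 - a], which is what is needed if
    [a >= 1/d], and to at most [(d - 1) a], which is what is needed if
    [a <= 1/d]. *)
Lemma axis_balls_cover x : (2 <= d)%N -> norm1 x <= 1 ->
  exists js : 'I_d * bool,
    norm1 (x - axis_point d%:R^-1 js.1 js.2) <= (d%:R - 1) / d%:R.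
Proof.
move=> d2 x1; have d0 : (0 < d)%N by apply: ltn_trans d2.
have dR : (2 <= d%:R :> R) by rewrite ler_nat.
have [j _ jmax] := arg_maxP (fun i => `|x ord0 i|) (isT : predT (Ordinal d0)).
exists (j, x ord0 j < 0); rewrite norm1_sub_axis /=.
set S := \sum_(i < d | _) _; set b := d%:R^-1 : R.
have -> : `|x ord0 j - (-1) ^+ (x ord0 j < 0)%R * b| = `| `|x ord0 j| - b|.
  case: ltrP => h; first by rewrite expr1 (ltr0_norm h) mulN1r -normrN opprD !opprK.
  by rewrite expr0 mul1r (ger0_norm h).
have S1 : S <= 1 - `|x ord0 j|.
  by rewrite lerBrDl; move: x1; rewrite /norm1 (bigD1 j).
have S2 : S <= (d%:R - 1) * `|x ord0 j|.
  have -> : (d%:R - 1) * `|x ord0 j| = \sum_(i < d | i != j) `|x ord0 j|.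
    by rewrite sumr_const cardC1 card_ord -[RHS]mulr_natl -subn1 natrB.
  by apply: ler_sum => i _; apply: jmax.
have db : d%:R * b = 1 by rewrite mulfV // pnatr_eq0 -lt0n.
rewrite -[_ / _]/((d%:R - 1) * b) mulrBl mul1r db.
(* [lerP] also resolves the absolute value in the goal. *)
have [hb|hb] := lerP b `|x ord0 j|; first by lra.
have : (d%:R - 2) * `|x ord0 j| <= (d%:R - 2) * b by rewrite ler_wpM2l ?subr_ge0 // ltW.
lra.
Qed.

Lemma covering_ratio_axis m : (2 <= d)%N -> (2 * d <= m)%N ->
  covering_ratios m (crosspolytope R d) ((d%:R - 1) / d%:R).
Proof.
move=> d2 dm; have dR : (2 <= d%:R :> R) by rewrite ler_nat.
have r0 : 0 < (d%:R - 1) / d%:R :> R by rewrite divr_gt0 //; lra.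
split=> //; pose c (js : 'I_d * bool) := axis_point d%:R^-1 js.1 js.2.
exists (fun k : 'I_m => nth 0 (fintype.image c predT) k) => x.
move=> /(axis_balls_cover d2)[js xjs].
have jsm : (enum_rank js < m)%N.
  apply: leq_trans (ltn_ord _) _.
  by rewrite card_prod card_ord card_bool mulnC.
exists (Ordinal jsm) => //; apply/homothetP => //.
have := nth_image 0 c (enum_rank js).
by rewrite enum_rankK => ->.
Qed.

(** * Lower bound *)

(** The colour of a sign vector is a ball that contains the facet centre with
    these signs.  Each vertex blocks one colour, and a ball of radius less than
    [(d - 1) / d] is too small for two facet centres at distance
    [2 (d - 1) / d]. *)
Lemma covering_colouring m (l : R) : (0 < d)%N ->
  covering_ratios m (crosspolytope R d) l -> l < (d%:R - 1) / d%:R ->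
  exists (c : ('I_d -> bool) -> 'I_m) (J : {set 'I_m}),
    [/\ #|J| = (m - 2 * d)%N, forall f, c f \in J
      & forall f g, (d.-1 <= #|[pred i | f i != g i]|)%N -> c f != c g].
Proof.
move=> d0 [l0 [u Ku]] ld.
have dR : 0 < d%:R :> R by rewrite ltr0n.
have l1 : l < 1.
  by apply: lt_le_trans ld _; rewrite ler_pdivrMr // mul1r gerBl.
have ball x : exists k, norm1 x <= 1 -> norm1 (x - u k) <= l.
  case: (lerP (norm1 x) 1) => [/Ku[k _ /homothetP xk]|_].
    by exists k => _; apply: xk.
  (* The centre of the crosspolytope lies in a ball, so there is an index. *)
  have [k _ _] : (\bigcup_i homothet l (crosspolytope R d) (u i)) 0.
    by apply: Ku; rewrite /crosspolytope /= big1 // => i _; rewrite mxE normr0.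
  by exists k.
have [b bP] := boolp.choice ball.
(* Two points of one ball have distance at most its diameter. *)
have far x y : norm1 x <= 1 -> norm1 y <= 1 -> 2 * l < norm1 (x - y) -> b x != b y.
  move=> x1 y1 xy; apply/eqP => bxy.
  have := norm1_triangle (u (b x)) x y; rewrite (norm1_distC (u (b x)) y).
  have := bP _ x1; have := bP _ y1; rewrite -bxy; lra.
have vertex1 j s : norm1 (axis_point 1 j s) <= 1 by rewrite norm1_axis normr1.
have facet1 f : norm1 (facet_centre f) <= 1 by rewrite norm1_facet_centre.
pose v (js : 'I_d * bool) := b (axis_point 1 js.1 js.2).
have v_inj : injective v.
  move=> [j s] [j' s'] /eqP; apply: contraTeq => jj'.
  by apply: far => //; rewrite vertex_dist //; lra.
exists (fun f => b (facet_centre f)), (~: (v @: [set: 'I_d * bool]%SET)).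
split.
- by rewrite cardsCs finset.setCK card_ord card_imset // cardsT card_prod card_ord
    card_bool mulnC.
- move=> f; rewrite inE; apply/imsetP => -[[j s] _] /eqP; apply/negP.
  apply: far => //; have := facet_centre_vertex_dist f j s; lra.
move=> f g fg; apply: far => //; rewrite facet_centre_dist -mulrA ltr_pM2l //.
apply: lt_le_trans ld _; rewrite ler_pM2r ?invr_gt0 //.
by rewrite -(@natrB _ d 1%N) // subn1 ler_nat.
Qed.

End L1.

(** * Dimensions 4 and 5 *)

(** In dimension 4 the signs are the bits of the word; in dimension 5,
    position 4 reads the default value of [nth], which is the parity bit. *)
Definition signs (d : nat) (x : word) (i : 'I_d) : bool :=
  nth (odd (count id (bits x))) (bits x) i.

Lemma clebsch_signs d x y : d = 4%N \/ d = 5%N -> clebsch x y ->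
  (d.-1 <= #|[pred i | @signs d x i != signs y i]|)%N.
Proof.
rewrite -sum1_card big_mkcond => -[] ->; rewrite !big_ord_recl big_ord0;
by case: x y => [[[[] []] []] []] [[[[] []] []] []].
Qed.

Theorem theorem4 (R : realType) (d m : nat)
    (hd : d = 4%N \/ d = 5%N) (hm : m = (2 * d + 3)%N) :
  gamma m (crosspolytope R d) = (d%:R - 1) / d%:R.
Proof.
have d2 : (2 <= d)%N by case: hd => ->.
have dR : (2 <= d%:R :> R) by rewrite ler_nat.
apply/gammaP; first by rewrite divr_gt0 //; lra.
split=> [|l Kl]; first by apply: covering_ratio_axis; rewrite // hm leq_addr.
rewrite leNgt; apply/negP => /(covering_colouring (ltnW d2) Kl)[c [J [cardJ cJ far]]].
have : (16 <= 5 * #|J|)%N.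
  apply: (@colouring_card _ (fun x => c (signs x))) => // x y xy.
  by apply: far; apply: clebsch_signs.
by rewrite cardJ hm addKn.
Qed.
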